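(* Let $d$ be any positive integer. For every finite simple graph $G$, it holds that \[\sigma_{\mathbb{T}}(G)=\sigma_{\mathbb{T}^d}(G).\]
   Context: For an abelian group $Z$ and a graph $G$, a set $A\subseteq Z$ is a coloring $Z$-base for $G$ if there exists a function $f:V(G)\to Z$ such that the sets $A+f(u)$ and $A+f(v)$ are disjoint for every edge $uv$ of $G$. For a compact abelian topological group $Z$ with Haar probability measure $\mu$, define $\sigma_Z(G)=\sup\{\mu(A): A \text{ is a Borel coloring } Z\text{-base for } G\}$. Here $\mathbb{T}=\mathbb{R}/\mathbb{Z}$, and $\mathbb{T}^d$ is the $d$-dimensional torus, each with its Haar probability measure. *)

(* Defs.v *)
From HB Require Import structures.
From mathcomp Require Import all_boot all_order all_algebra.
From mathcomp Require Import generic_quotient ring_quotient.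
From mathcomp Require Import all_classical all_reals all_analysis.
From mathcomp Require Import ring lra.

Set Implicit Arguments.
Unset Strict Implicit.
Unset Printing Implicit Defensive.

Import Order.TTheory GRing.Theory Num.Theory.
Import numFieldNormedType.Exports.

Local Open Scope classical_set_scope.
Local Open Scope ring_scope.
Local Open Scope quotient_scope.

HB.mixin Record TopologicalZmodule_isCompactHausdorff M
    of TopologicalZmodule M := {
  compact_zmod_setT : compact [set: M];
  compact_zmod_hausdorff : hausdorff_space M
}.

#[short(type="compactZmodType")]
HB.structure Definition CompactZmodule :=
  {M of TopologicalZmodule M & TopologicalZmodule_isCompactHausdorff M}.

(* Z with its Borel sigma-algebra; pointed at 0 because measurable types are
   pointed. *)
Definition borel (Z : topologicalZmodType) : Type := Z.

HB.instance Definition _ (Z : topologicalZmodType) :=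
  TopologicalZmodule.copy (borel Z) Z.
HB.instance Definition _ (Z : topologicalZmodType) :=
  isPointed.Build (borel Z) 0.
HB.instance Definition _ (Z : topologicalZmodType) :=
  Measurable.copy (borel Z) (g_sigma_algebraType (@open (borel Z))).

Definition translate (Z : zmodType) (A : set Z) (z : Z) : set Z :=
  [set a + z | a in A].

(* Existence and uniqueness of such a mu is Haar's theorem.  The two
   regularity clauses are part of the definition for a general compact group;
   when Z is metrizable, every Borel probability measure satisfies them. *)
Record is_haar (R : realType) (Z : compactZmodType)
    (mu : probability (borel Z) R) : Prop := IsHaar {
  haar_invariant : forall (A : set (borel Z)) (z : Z),
    measurable A -> mu (translate (A : set Z) z) = mu A;
  haar_outer_regular : forall A : set (borel Z), measurable A ->
    mu A = ereal_inf [set mu U | U in [set U : set Z | open U /\ A `<=` U]];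
  haar_inner_regular : forall U : set Z, open U ->
    mu U = ereal_sup [set mu K | K in [set K : set Z | compact K /\ K `<=` U]]
}.

Record sgraph := SGraph {
  vertex :> finType;
  edge : rel vertex;
  edge_sym : symmetric edge;
  edge_irrefl : irreflexive edge
}.

Definition coloring_base (Z : zmodType) (G : sgraph) (A : set Z) : Prop :=
  exists f : G -> Z, forall u v : G, edge u v ->
    translate A (f u) `&` translate A (f v) = set0.

Definition sigma (R : realType) (Z : compactZmodType)
    (mu : probability (borel Z) R) (G : sgraph) : \bar R :=
  ereal_sup [set mu A | A in
    [set A : set (borel Z) | measurable A /\ coloring_base G (A : set Z)]].

(* Num.int_num_subdef is the predicate underlying Num.int. *)
Definition int_subgroup (R : realType) : zmodClosed R :=
  GRing.ZmodClosed.clone R (@Num.int_num_subdef R) _.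

Definition circle (R : realType) : Type :=
  quotient_topology (Quotient.quot (int_subgroup R)).

Section circle_group.
Variable R : realType.

Local Notation Q := (Quotient.quot (int_subgroup R)).
Local Notation T := (circle R).

HB.instance Definition _ := PointedTopological.copy T (quotient_topology Q).
HB.instance Definition _ := Quotient.copy T Q.
(* The group law of Q; only the choiceType structures of Q and T differ. *)
HB.instance Definition _ := GRing.isZmodule.Build T
  (@Quotient.addqA R (int_subgroup R)) (@Quotient.addqC R (int_subgroup R))
  (@Quotient.add0q R (int_subgroup R)) (@Quotient.addNq R (int_subgroup R)).

Lemma pi_circle_eq (x y : R) : \pi_T x = \pi_T y <-> x - y \is a Num.int.
Proof.
by rewrite [_ \is a _](Quotient.idealrBE (int_subgroup R)); split=> [e|/eqP]; [apply/eqP|].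
Qed.

Lemma pi_circleB (x y : R) : \pi_T (x - y) = \pi_T x - \pi_T y.
Proof. exact: (raddfB (\pi_Q : R -> Q)). Qed.

Lemma pi_circle_open (A : set R) : open A -> open (\pi_T @` A).
Proof.
move=> oA; rewrite [open _](_ : _ = open (\pi_T @^-1` (\pi_T @` A)))//.
rewrite openE => x [a Aa /esym/pi_circle_eq xa].
have ca : continuous (fun y : R => y - (x - a)).
  by move=> y; apply: cvgB; [exact: cvg_id|exact: cvg_cst].
have : nbhs (x - (x - a)) A by rewrite subKr; exact: open_nbhs_nbhs.
move=> /ca nA; apply: (@filterS R (nbhs (x : R)) _ _ _ _ nA) => y Ay; exists (y - (x - a)) => //.
by apply/pi_circle_eq; rewrite addrC addKr rpredN.
Qed.

Lemma pi_circle_nbhs (x e : R) : 0 < e -> nbhs (\pi_T x) (\pi_T @` ball x e).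
Proof.
move=> e0; apply: open_nbhs_nbhs; split.
  by apply: pi_circle_open; exact: ball_open.
by exists x => //; exact: ballxx.
Qed.

Fact circle_sub_continuous : continuous (fun x : T * T => x.1 - x.2).
Proof.
move=> [p q] U /=; rewrite -[p]reprK -[q]reprK -pi_circleB => nU.
have /nbhs_ballP[e /= e0 eU] := pi_continuous nU.
exists (\pi_T @` ball (repr p) (e / 2), \pi_T @` ball (repr q) (e / 2)).
  by split; apply: pi_circle_nbhs; rewrite divr_gt0.
move=> [_ _] [[x /= px <-] [y /= qy <-]]; rewrite -pi_circleB; apply: eU.
rewrite /ball/= (_ : _ - _ = (repr p - x) - (repr q - y)); last by ring.
by rewrite (le_lt_trans (ler_normB _ _))// (splitr e) ltrD.
Qed.

HB.instance Definition _ :=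
  PreTopologicalNmodule_isTopologicalZmodule.Build T circle_sub_continuous.

Fact circle_compact : compact [set: T].
Proof.
rewrite (_ : setT = \pi_T @` `[0, 1]).
  apply: continuous_compact; last exact: segment_compact.
  exact/continuous_subspaceT/pi_continuous.
apply/seteqP; split => // p _; set x := repr p.
exists (x - (Num.floor x)%:~R).
  have /andP[] := floor_itv x; rewrite intrD /= in_itv/= => ? ?.
  by apply/andP; split; lra.
rewrite -[RHS]reprK; apply/pi_circle_eq.
by rewrite addrAC subrr add0r rpredN intr_int.
Qed.

Fact circle_hausdorff : hausdorff_space T.
Proof.
move=> p q; rewrite -[p]reprK -[q]reprK.
set a := repr p; set b := repr q => pq; apply/pi_circle_eq/negPn/negP => abN.
set t := a - b in abN *; set n := Num.floor t.
have /andP[] := floor_itv t; rewrite -/n le_eqVlt => /predU1P[nt|nt tn].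
  by move/negP: abN; case; rewrite -nt intr_int.
pose e := Num.min (t - n%:~R) ((n + 1)%:~R - t).
have e2 : 0 < e / 2 by rewrite divr_gt0// lt_min !subr_gt0 nt.
have [_ [[x ax <-] [y yb]]] := pq _ _ (pi_circle_nbhs a e2) (pi_circle_nbhs b e2).
move=> /esym/pi_circle_eq/intrP[m xy].
have : `|t - m%:~R| < e.
  rewrite -xy (_ : _ - _ = (a - x) - (b - y)); last by rewrite /t; ring.
  by rewrite (le_lt_trans (ler_normB _ _))// (splitr e) ltrD.
rewrite lt_min !ltr_norml => /andP[/andP[_ tmn] /andP[tmn1 _]].
have : n < m by rewrite -(ltr_int R); lra.
by apply/negP; rewrite -leNgt -ltzD1 -(ltr_int R); lra.
Qed.

HB.instance Definition _ :=
  TopologicalZmodule_isCompactHausdorff.Build T circle_compact circle_hausdorff.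

End circle_group.

Definition torus (R : realType) (d : nat) : Type := 'rV[circle R]_d.

Section torus_group.
Variables (R : realType) (d : nat).

Local Notation T := (circle R).
Local Notation Td := (torus R d).

HB.instance Definition _ := PointedTopological.copy Td 'rV[T]_d.
HB.instance Definition _ := GRing.Zmodule.copy Td 'rV[T]_d.

Fact torus_sub_continuous : continuous (fun x : Td * Td => x.1 - x.2).
Proof.
move=> [M N] U /= [P nP PU].
have {}nP i j : exists VW : set T * set T,
    [/\ nbhs (M i j) VW.1, nbhs (N i j) VW.2 &
        forall x y, VW.1 x -> VW.2 y -> P i j (x - y)].
  have /(circle_sub_continuous (x := (M i j, N i j)))[VW [nV nW] VWP] :
    nbhs (M i j - N i j) (P i j) by have := nP i j; rewrite !mxE.
  by exists VW; split => // x y Vx Wy; exact: (VWP (x, y)).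
have [VW VWP] := choice (fun ij => nP ij.1 ij.2).
exists ([set A : Td | forall i j, (VW (i, j)).1 (A i j)],
        [set B : Td | forall i j, (VW (i, j)).2 (B i j)]).
  split; [exists (fun i j => (VW (i, j)).1)|exists (fun i j => (VW (i, j)).2)];
    by [|move=> i j; have [] := VWP (i, j)].
move=> [A B] [/= VA WB]; apply: PU => i j; rewrite !mxE.
by have [_ _] := VWP (i, j); apply.
Qed.

HB.instance Definition _ :=
  PreTopologicalNmodule_isTopologicalZmodule.Build Td torus_sub_continuous.

Fact torus_compact : compact [set: Td].
Proof.
rewrite (_ : setT = [set v : 'rV[T]_d | forall i, [set: T] (v ord0 i)]).
  by apply: (@rV_compact T d (fun=> setT)) => _; exact: circle_compact.
by apply/seteqP; split.
Qed.

Fact torus_hausdorff : hausdorff_space Td.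
Proof.
move=> A B AB; apply/matrixP => i j; apply: circle_hausdorff => U V nU nV.
have [||C [UC VC]] := AB [set C : Td | U (C i j)] [set C : Td | V (C i j)].
- exists (fun i' j' => [set x | (i', j') = (i, j) -> U x]) => [i' j'|C]; last exact.
  have [[-> ->]|ne] := pselect ((i', j') = (i, j)); first by apply: filterS nU => x + _.
  by apply: filterS filterT => x _ /ne.
- exists (fun i' j' => [set x | (i', j') = (i, j) -> V x]) => [i' j'|C]; last exact.
  have [[-> ->]|ne] := pselect ((i', j') = (i, j)); first by apply: filterS nV => x + _.
  by apply: filterS filterT => x _ /ne.
- by exists (C i j).
Qed.

HB.instance Definition _ := TopologicalZmodule_isCompactHausdorff.Build Td
  torus_compact torus_hausdorff.

End torus_group.

(* Main.v *)
(** Cut the circle into [M] half-open arcs, indexed by Z/M, so that translation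
by 1/M increases the index by 1.  Similarly cut the torus into boxes with [N_i]
arcs in direction [i]: if the [N_i] are pairwise coprime, the Chinese remainder
theorem indexes the boxes by Z/M with [M] the product of the [N_i], and
translation by (1/N_1, ..., 1/N_d) increases the index by 1.  By invariance every
cell has Haar measure 1/M in both groups.

A Borel coloring base [A] contains, up to measure epsilon, a compact coloring base
[K], whose translates along an edge are a positive distance apart.  For a fine
enough partition the indices of the cells meeting [K] thus form a coloring base of
Z/M of density at least the measure of [K], and pulling it back to the other group
gives a coloring base of measure equal to that density. *)
Require Import Defs.
From mathcomp Require Import all_boot all_order all_algebra.
From mathcomp Require Import all_classical all_reals all_analysis.
From mathcomp Require Import ring lra.

Set Implicit Arguments.
Unset Strict Implicit.
Unset Printing Implicit Defensive.

Import Order.TTheory GRing.Theory Num.Theory.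
Import numFieldNormedType.Exports.

Local Open Scope classical_set_scope.
Local Open Scope ring_scope.
Local Open Scope quotient_scope.

(** * Partitions of a group into cyclically permuted cells *)

(** The map [c] is a discrete stand-in for a homomorphism to Z/M: it respects translation by
    multiples of [t] only. Normalizing by [cell0] puts [t *+ n] in cell [n] for [n < M], so every
    cell contains a multiple of [t]. *)
Record cyclic_partition (Z : topologicalZmodType) (M : nat) (c : Z -> nat) (t : Z)
    : Prop := CyclicPartition {
  cell_lt : forall x, (c x < M)%N;
  cell0 : c 0 = 0%N;
  cellD : forall x, c (x + t) = ((c x).+1 %% M)%N;
  cell_measurable : forall a, measurable [set x : borel Z | c x = a]
}.

Section cyclic_partition_theory.
Variables (Z : topologicalZmodType) (M : nat) (c : Z -> nat) (t : Z).
Hypothesis cP : cyclic_partition M c t.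

Lemma cyclic_partition_gt0 : (0 < M)%N.
Proof. by apply: leq_ltn_trans (cell_lt cP 0). Qed.

Lemma cell_mulrn x n : c (x + t *+ n) = ((c x + n) %% M)%N.
Proof.
elim: n => [|n IH]; first by rewrite mulr0n addr0 addn0 modn_small ?(cell_lt cP).
by rewrite mulrSr addrA (cellD cP) IH -addn1 modnDml addn1 addnS.
Qed.

Lemma cell_mulrn0 n : (n < M)%N -> c (t *+ n) = n.
Proof. by move=> nM; rewrite -[t *+ n]add0r cell_mulrn (cell0 cP) modn_small. Qed.

Lemma cell_preimage_measurable (S : set nat) : measurable (c @^-1` S : set (borel Z)).
Proof.
rewrite (_ : c @^-1` S = \bigcup_(a in S) [set x : borel Z | c x = a]).
  by apply: bigcup_measurable => k _; exact: (cell_measurable cP).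
by apply/seteqP; split => [x Sx|x [a Sa ca]]; [exists (c x)|rewrite /preimage/= (ca : c x = a)].
Qed.

Lemma cell_translate n : (n < M)%N ->
  [set x : Z | c x = n] = translate [set x : Z | c x = 0%N] (t *+ n).
Proof.
move=> nM; apply/seteqP; split => [x /= cx|_ [x /= cx <-]]; last first.
  by rewrite cell_mulrn cx modn_small.
exists (x - t *+ n); last by rewrite subrK.
have : (c (x - t *+ n)%R + n == 0 + n %[mod M])%N.
  by rewrite -cell_mulrn subrK cx add0n modn_small.
by rewrite eqn_modDr mod0n modn_small ?(cell_lt cP)// => /eqP.
Qed.

End cyclic_partition_theory.

(** Cell [n] is the translate of cell 0 by [t *+ n], so invariance gives all cells the same measure.
    The right-hand side depends on [M] and [S] alone, which allows comparison across groups. *)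
Lemma cell_preimage_measure (R : realType) (Z : compactZmodType)
    (mu : probability (borel Z) R) (M : nat) (c : Z -> nat) (t : Z) (S : set nat) :
  is_haar mu -> cyclic_partition M c t ->
  mu (c @^-1` S) = (\sum_(a \in `I_M `&` S) (M%:R^-1 : R)%:E)%E.
Proof.
move=> muH cP; pose F a := [set x : borel Z | c x = a].
have mF a : measurable (F a) := cell_measurable cP a.
have sumF D : D `<=` `I_M -> mu (c @^-1` D) = (\sum_(a \in D) mu (F 0%N))%E.
  move=> DM; rewrite (_ : c @^-1` D = \bigcup_(a in D) F a); last first.
    by apply/seteqP; split => [x Sx|x [a Sa ca]]; [exists (c x)|rewrite /preimage/= (ca : c x = a)].
  rewrite measure_fin_bigcup//; last first.
  - by move=> a b _ _ [x [/= <- <-]].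
  - by apply: sub_finite_set DM _; exact: finite_II.
  apply: eq_fsbigr => a; rewrite inE => /DM aM.
  by have := haar_invariant muH (t *+ a) (mF 0%N); rewrite -(cell_translate cP aM).
have M0 : M%:R != 0 :> R by rewrite pnatr_eq0 -lt0n (cyclic_partition_gt0 cP).
(* The common value is found by summing over all [M] cells, whose union has measure 1. *)
have -> : ((M%:R^-1 : R)%:E = mu (F 0%N))%E.
  have := sumF _ (@subset_refl _ `I_M).
  rewrite (_ : c @^-1` _ = setT); last first.
    by apply/seteqP; split => // x _; exact: (cell_lt cP).
  rewrite probability_setT -fsbig_ord.
  have -> : mu (F 0%N) = (fine (mu (F 0%N)))%:E by rewrite fineK ?fin_num_measure.
  rewrite sumEFin sumr_const card_ord => -[e].
  by congr EFin; apply: (mulIf M0); rewrite mulVf// mulr_natr.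
rewrite -sumF; last by move=> a [].
by congr (mu _); apply/seteqP; split => [x Sx|x []//]; split; [exact: (cell_lt cP)|].
Qed.

(** * Compact approximation, separation and comparison of [sigma] *)

(** Outer regularity of the complement of [A] gives an open [U] around it; the complement of [U] is
    closed in a compact space, hence compact. *)
Lemma haar_compact_approx (R : realType) (Z : compactZmodType)
    (mu : probability (borel Z) R) (A : set (borel Z)) (e : R) :
  is_haar mu -> measurable A -> 0 < e ->
  exists K : set Z, [/\ compact K, K `<=` A & (mu A <= mu K + e%:E)%E].
Proof.
move=> muH mA e0; have mCA := measurableC mA.
have := haar_outer_regular muH mCA; set I := ereal_inf _ => muI.
have Ifin : I \is a fin_num by rewrite -muI fin_num_measure.
have [_ [U [oU AU] <-] Ue] := lb_ereal_inf_adherent e0 Ifin.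
have mU : measurable (U : set (borel Z)) by exact: sub_sigma_algebra.
exists (~` U); split.
- apply: subclosed_compact (@compact_zmod_setT Z) _ => //; exact: open_closedC.
- by move=> x Ux; apply: contrapT => /AU.
have {}Ue : (mu U < 1 - mu A + e%:E)%E by rewrite -probability_setC// muI.
rewrite [X in (_ <= X + _)%E](_ : _ = 1 - mu U)%E; last exact: probability_setC.
have: mu A \is a fin_num by exact: fin_num_measure.
have: mu U \is a fin_num by exact: fin_num_measure.
move: Ue; case: (mu U) => // u; case: (mu A) => // a.
by rewrite lte_fin lee_fin => ? _ _; lra.
Qed.

(** The difference set [E] of [K] is compact, hence closed, and misses [f v - f u] for each edge. A
    neighbourhood of each such point misses it too, and there are finitely many edges. *)
Lemma compact_coloring_base_margin (Z : compactZmodType) (G : sgraph) (K : set Z)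
    (f : G -> Z) : compact K ->
  (forall u v, edge u v -> translate K (f u) `&` translate K (f v) = set0) ->
  exists2 N : set Z, nbhs 0 N & forall u v x y, edge u v -> K x -> K y ->
    ~ N ((x + f u) - (y + f v)).
Proof.
move=> cK Kf.
pose E := (fun p : Z * Z => p.1 - p.2) @` (K `*` K).
have cE : closed E.
  apply: compact_closed; first exact: compact_zmod_hausdorff.
  apply: continuous_compact; last exact: compact_setX.
  by apply: continuous_subspaceT; exact: sub_continuous.
exists [set w | forall uv : G * G, edge uv.1 uv.2 -> ~ E (w - (f uv.1 - f uv.2))].
  apply: filter_forall => -[u v].
  have [uv|_] := boolP (edge u v); last exact: filterE.
  have cg : {for 0, continuous (fun w : Z => w - (f u - f v))}.
    apply: (@continuous_comp _ _ _ (fun w : Z => (w, f u - f v))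
      (fun p : Z * Z => p.1 - p.2)); last exact: sub_continuous.
    by apply: cvg_pair; [exact: cvg_id|exact: cvg_cst].
  have : nbhs (0 - (f u - f v)) (~` E).
    apply: open_nbhs_nbhs; split; first exact: closed_openC.
    move=> [[x y] /= [Kx Ky]] xy; have /eqP := Kf _ _ uv.
    apply/negP/set0P; exists (x + f u); split; first by exists x.
    by exists y => //; move/eqP: xy; rewrite sub0r opprB subr_eq => /eqP ->; rewrite addrAC subrK addrC.
  by move=> /cg nE; apply: (@filterS _ (nbhs (0 : Z)) _ _ _ _ nE) => w wE _.
move=> u v x y uv Kx Ky /(_ (u, v) uv); apply.
by exists (x, y) => //=; rewrite (opprD y) addrACA addrK.
Qed.

Lemma nbhs0_add_sub (Z : topologicalZmodType) (N : set Z) : nbhs 0 N ->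
  exists2 W : set Z, nbhs 0 W & forall x y z, W x -> W y -> W z -> N (x + y - z).
Proof.
move=> nN.
have sub0 (P : set Z) : nbhs 0 P ->
    exists2 W : set Z, nbhs 0 W & forall x y, W x -> W y -> P (x - y).
  move=> nP; have := @sub_continuous Z (0, 0) P.
  rewrite /= subr0 => /(_ nP)[[U V] /= [nU nV] UVP].
  by exists (U `&` V) => [|x y [Ux _] [_ Vy]]; [exact: filterI|exact: (UVP (x, y))].
have [W1 nW1 W1N] := sub0 _ nN; have [W2 nW2 W2W1] := sub0 _ nW1.
exists (W1 `&` W2) => [|x y z [W1x _] [_ W2y] [_ W2z]]; first exact: filterI.
by rewrite -addrA -opprB; apply: W1N => //; exact: W2W1.
Qed.

(* [c1] and [c2] take values in the same cyclic group: by [cell_preimage_measure],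
   a set of indices has preimages of equal measure in [Z1] and [Z2]. *)
Definition fine_common_partitions (Z1 Z2 : topologicalZmodType) : Prop :=
  forall W : set Z1, nbhs 0 W -> exists M c1 t1 c2 t2,
    [/\ @cyclic_partition Z1 M c1 t1, @cyclic_partition Z2 M c2 t2 &
        forall x y, c1 x = c1 y -> W (x - y)].

Lemma sigma_le (R : realType) (Z1 Z2 : compactZmodType)
    (mu1 : probability (borel Z1) R) (mu2 : probability (borel Z2) R)
    (G : sgraph) : is_haar mu1 -> is_haar mu2 -> fine_common_partitions Z1 Z2 ->
  (sigma mu1 G <= sigma mu2 G)%E.
Proof.
move=> mu1H mu2H fine; apply: ge_ereal_sup => _ [A [mA [f fA]] <-].
apply/lee_addgt0Pr => e e0.
have [K [cK KA /le_trans]] := haar_compact_approx mu1H mA e0; apply.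
rewrite leeD2r//.
have fK u v : edge u v -> translate K (f u) `&` translate K (f v) = set0.
  move=> /fA AA; apply/seteqP; split => // x [[a Ka ax] [b Kb bx]].
  by rewrite -AA; split; [exists a => //; exact: KA|exists b => //; exact: KA].
have [N nN NK] := compact_coloring_base_margin cK fK.
have [W nW WN] := nbhs0_add_sub nN.
have [M [c1 [t1 [c2 [t2 [P1 P2 c1W]]]]]] := fine _ nW.
pose S := c1 @` K.
have mK : measurable (K : set (borel Z1)).
  rewrite -[K]setCK; apply: measurableC; apply: sub_sigma_algebra.
  by apply: closed_openC; apply: compact_closed => //; exact: compact_zmod_hausdorff.
have KS : (mu1 K <= mu2 (c2 @^-1` S))%E.
  rewrite (cell_preimage_measure _ mu2H P2) -(cell_preimage_measure _ mu1H P1).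
  apply: le_measure; rewrite ?inE//; first exact: (cell_preimage_measurable P1).
  by move=> x Kx; exists x.
apply: le_trans KS _; apply: ereal_sup_ubound; exists (c2 @^-1` S) => //; split.
  exact: (cell_preimage_measurable P2).
(* Each shift [f u] is rounded to the multiple of the generator in its cell; that multiple is then
   read in [Z2]. *)
pose g u := c1 (f u); exists (fun u => t2 *+ g u) => u v uv.
apply/seteqP; split => // _ [[a [k Kk ck] <-] [b [l Kl cl] ab]].
(* A collision in [Z2] is an equality of indices modulo [M], so the matching points of [Z1] share a
   cell. *)
have kl : W ((k + t1 *+ g u) - (l + t1 *+ g v)).
  by apply: c1W; rewrite !(cell_mulrn P1) ck cl -!(cell_mulrn P2) ab.
have Wf w : W (f w - t1 *+ g w).
  by apply: c1W; rewrite (cell_mulrn0 P1)// (cell_lt P1).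
(* Undoing both roundings turns [kl] into a statement about [(k + f u) - (l + f v)]; this costs
   three elements of [W] and contradicts the margin [N]. *)
apply: (NK u v k l uv Kk Kl); have := WN _ _ _ kl (Wf u) (Wf v).
by rewrite (addrAC (k + _)) (addrACA k) subrr addr0 -(addrA (k + _)) -opprD
  (addrACA l) subrr addr0.
Qed.

(** * Arcs of the circle *)

Definition circle_cell (R : realType) (N : nat) (p : circle R) : nat :=
  `|(Num.floor (N%:R * repr p) %% N)%Z|%N.

Section circle_cells.
Variable R : realType.
Local Notation T := (circle R).

Lemma pi_circleD (x y : R) : \pi_T (x + y) = \pi_T x + \pi_T y.
Proof. by apply/eqP; rewrite -subr_eq -pi_circleB addrK. Qed.

Lemma pi_circle0 : \pi_T (0 : R) = 0.
Proof. by rewrite -[X in \pi_T X](subrr (0 : R)) pi_circleB subrr. Qed.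

(** Frees the index from the arbitrary representative [repr p]: a change by an integer [m] moves the
    floor by [m * N], which vanishes modulo [N]. *)
Lemma circle_cellP (N a : nat) (p : T) : (a < N)%N ->
  circle_cell N p = a <-> exists2 y : R, a%:R <= N%:R * y < a%:R + 1 & p = \pi_T y.
Proof.
move=> aN; have N0 : (0 < N)%N by apply: leq_ltn_trans aN.
split=> [pa|[y yN ->]].
  pose z := Num.floor (N%:R * repr p).
  pose q := (z %/ N)%Z.
  have za : z = q * N + a%:Z.
    by rewrite -pa gez0_abs ?modz_ge0 ?eqz_nat -?lt0n// -divz_eq.
  exists (repr p - q%:~R).
    have /andP[] := floor_itv (N%:R * repr p).
    rewrite -/z za !intrD intrM !pmulrn => ? ?.
    by apply/andP; split; lra.
  rewrite -[LHS]reprK; apply/pi_circle_eq.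
  by rewrite opprB addrC subrK intr_int.
have /pi_circle_eq/intrP[m ym] : \pi_T (repr (\pi_T y)) = \pi_T y by rewrite reprK.
have ry : repr (\pi_T y) = y + m%:~R by rewrite -ym addrC subrK.
rewrite /circle_cell ry (_ : N%:R * _ = N%:R * y + (m * N%:Z)%:~R); last first.
  by rewrite intrM -pmulrn; ring.
rewrite floorDrz ?intr_int// intrKfloor (floor_def (m := a%:Z)).
  by rewrite addrC modzMDl modz_small ?absz_nat//= ltz_nat aN.
by rewrite intrD -!pmulrn.
Qed.

Lemma circle_cell_lt (N : nat) (p : T) : (0 < N)%N -> (circle_cell N p < N)%N.
Proof.
move=> N0; rewrite -ltz_nat gez0_abs ?modz_ge0 ?eqz_nat -?lt0n//.
by rewrite ltz_pmod// ltz_nat.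
Qed.

Lemma circle_cell_pi0 (N : nat) : (0 < N)%N -> circle_cell N (0 : T) = 0%N.
Proof.
by move=> N0; apply/circle_cellP => //; exists 0; rewrite ?pi_circle0// mulr0 lexx add0r ltr01.
Qed.

Lemma circle_cellD (N : nat) (p : T) : (0 < N)%N ->
  circle_cell N (p + \pi_T (N%:R^-1)) = ((circle_cell N p).+1 %% N)%N.
Proof.
move=> N0; have Nr : N%:R != 0 :> R by rewrite pnatr_eq0 -lt0n.
have aN := circle_cell_lt p N0; set a := circle_cell N p in aN *.
have /(circle_cellP _ aN)[y ya py] : circle_cell N p = a by [].
move: aN; rewrite leq_eqVlt => /predU1P[aN|aN].
  (* From the last arc the translation wraps around to arc 0, so the representative drops by a full
     turn. *)
  rewrite aN modnn; apply/circle_cellP => //; exists (y + N%:R^-1 - 1).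
    by rewrite mulrBr mulrDr divff// mulr1; move: ya; rewrite -aN -natr1 => /andP[? ?]; lra.
  rewrite py -pi_circleD; apply/pi_circle_eq.
  by rewrite opprB addrC subrK.
rewrite modn_small//; apply/circle_cellP => //; exists (y + N%:R^-1).
  by rewrite mulrDr divff// -natr1; move: ya => /andP[? ?]; lra.
by rewrite py pi_circleD.
Qed.

Lemma circle_cell_sub (N : nat) (p q : T) : (0 < N)%N ->
  circle_cell N p = circle_cell N q ->
  exists2 e : R, `|e| < N%:R^-1 & p - q = \pi_T e.
Proof.
move=> N0 pq; have aN := circle_cell_lt q N0.
have [x xa ->] := (circle_cellP p aN).1 pq.
have [y ya ->] := (circle_cellP q aN).1 erefl.
exists (x - y); last by rewrite pi_circleB.
have Nr : 0 < N%:R :> R by rewrite ltr0n.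
rewrite -(ltr_pM2l Nr) divff ?gt_eqF// -{1}(gtr0_norm Nr) -normrM ltr_norml.
by rewrite mulrBr; move: xa ya => /andP[? ?] /andP[? ?]; lra.
Qed.

(** A half-open arc is an open arc together with its left endpoint, a closed point. The map [g]
    covers both the identity of the circle and the torus coordinates. *)
Lemma circle_cell_preimage_measurable (Z : topologicalZmodType) (g : Z -> T) (N a : nat) :
  (0 < N)%N -> continuous g -> measurable [set x : borel Z | circle_cell N (g x) = a].
Proof.
move=> N0 cg; have [aN|Na] := ltnP a N; last first.
  rewrite (_ : [set x | _] = set0)//; apply/seteqP; split => // x /= xa.
  by have := circle_cell_lt (g x) N0; rewrite xa ltnNge Na.
have Nr : 0 < N%:R :> R by rewrite ltr0n.
pose I : set R := [set` `](a%:R / N%:R), ((a%:R + 1) / N%:R)[].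
rewrite (_ : [set x | _] = g @^-1` (\pi_T @` I) `|` g @^-1` [set \pi_T (a%:R / N%:R)]).
  apply: measurableU.
    apply: sub_sigma_algebra; apply: open_comp => //.
    by apply: pi_circle_open; exact: interval_open.
  rewrite -[X in measurable X]setCK; apply: measurableC; apply: sub_sigma_algebra.
  apply: closed_openC; apply: closed_comp => //.
  by apply: accessible_closed_set1; apply: hausdorff_accessible; exact: circle_hausdorff.
apply/seteqP; split => [x /(circle_cellP _ aN)[y ya gy]|x].
  have /andP[] := ya; rewrite le_eqVlt => /predU1P[ay|ay] yb.
    by right; rewrite /preimage/= gy ay mulrAC divff ?mul1r// gt_eqF.
  left; rewrite /preimage/= gy; exists y => //.
  by rewrite /I/= in_itv/= ltr_pdivrMr// ltr_pdivlMr// mulrC ay.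
case=> [[y]|/=]; rewrite /I/= ?in_itv/=.
  rewrite ltr_pdivrMr// ltr_pdivlMr// mulrC => /andP[ay yb] gy.
  by apply/circle_cellP => //; exists y => //; rewrite (ltW ay).
move=> gx; apply/circle_cellP => //; exists (a%:R / N%:R) => //.
by rewrite mulrC divfK ?gt_eqF// lexx ltrDl ltr01.
Qed.

Lemma circle_cell_partition (Z : topologicalZmodType) (g : Z -> T) (N : nat) (t : Z) :
  (0 < N)%N -> continuous g -> {morph g : x y / x - y} -> g t = \pi_T (N%:R^-1) ->
  cyclic_partition N (circle_cell N \o g) t.
Proof.
move=> N0 cg gB gt.
have g0 : g 0 = 0 by rewrite -(subrr 0) gB subrr.
have gD x : g (x + t) = g x + g t by apply/eqP; rewrite -subr_eq -gB addrK.
split=> [x||x|a] /=; first exact: circle_cell_lt.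
- by rewrite g0 circle_cell_pi0.
- by rewrite gD gt circle_cellD.
- exact: circle_cell_preimage_measurable.
Qed.

Lemma nbhs_circle0 (V : set T) : nbhs 0 V ->
  exists n : nat, forall (N : nat) (e : R), (n < N)%N -> `|e| < N%:R^-1 -> V (\pi_T e).
Proof.
rewrite -pi_circle0 => /(@pi_continuous _ _ (0 : R)) /nbhs_ballP[e /= e0 eV].
(* Any [N] above this bound satisfies [N%:R^-1 < e]. *)
exists (Num.truncn e^-1) => N x nN xN; apply: eV; rewrite /ball/= sub0r normrN.
apply: lt_trans xN _; have Nr : 0 < N%:R :> R by rewrite ltr0n (leq_ltn_trans _ nN).
rewrite invf_plt//; apply: lt_le_trans (truncnS_gt _) _.
by rewrite ler_nat.
Qed.

End circle_cells.

(** * Combining partitions of coprime orders *)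

(** The new index is the residue modulo [M * N] that reduces to [c x] and [c' x]. Both indices
    advance by 1 under the same [t], hence so does the residue. *)
Lemma cyclic_partition_chinese (Z : topologicalZmodType) (M N : nat)
    (c c' : Z -> nat) (t : Z) :
  coprime M N -> cyclic_partition M c t -> cyclic_partition N c' t ->
  exists2 b : Z -> nat, cyclic_partition (M * N) b t &
    forall x y, b x = b y -> c x = c y /\ c' x = c' y.
Proof.
move=> MN cP c'P; have M0 := cyclic_partition_gt0 cP.
have N0 := cyclic_partition_gt0 c'P; have MN0 : (0 < M * N)%N by rewrite muln_gt0 M0.
pose b x := (chinese M N (c x) (c' x) %% (M * N))%N.
have bM x : (b x %% M)%N = c x.
  by rewrite modn_dvdm ?dvdn_mulr// chinese_modl// modn_small ?(cell_lt cP).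
have bN x : (b x %% N)%N = c' x.
  by rewrite modn_dvdm ?dvdn_mull// chinese_modr// modn_small ?(cell_lt c'P).
have bP x a : (a < M * N)%N -> c x = (a %% M)%N -> c' x = (a %% N)%N -> b x = a.
  move=> aMN ca c'a; suff /eqP : (b x == a %[mod M * N])%N by rewrite !modn_small// ltn_pmod.
  by rewrite chinese_remainder// bM bN ca c'a !eqxx.
exists b => [|x y xy]; last by rewrite -bM -[c y]bM -bN -[c' y]bN xy.
split=> [x||x|a]; first by rewrite ltn_pmod.
- by apply: bP => //; rewrite mod0n ?(cell0 cP) ?(cell0 c'P).
- apply: bP; rewrite ?ltn_pmod//.
    by rewrite modn_dvdm ?dvdn_mulr// (cellD cP) -bM -addn1 modnDml addn1.
  by rewrite modn_dvdm ?dvdn_mull// (cellD c'P) -bN -addn1 modnDml addn1.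
- have [aMN|MNa] := ltnP a (M * N); last first.
    rewrite (_ : [set x | _] = set0)//; apply/seteqP; split => // x /= xa.
    by move: MNa; rewrite -xa leqNgt ltn_pmod.
  rewrite (_ : [set x | _] = [set x : borel Z | c x = (a %% M)%N] `&`
                             [set x : borel Z | c' x = (a %% N)%N]).
    by apply: measurableI; [exact: (cell_measurable cP)|exact: (cell_measurable c'P)].
  by apply/seteqP; split => [x /= <-|x [/= ? ?]]; [rewrite bM bN|exact: bP].
Qed.

(** * Boxes of the torus *)

Section torus_cells.
Variables (R : realType) (d : nat).
Local Notation T := (circle R).
Local Notation Td := (torus R d).

Lemma torus_coord_continuous (i : 'I_d) : continuous (fun x : Td => x ord0 i : T).
Proof.
move=> x U nU; exists (fun i' j' => [set p | (i', j') = (ord0, i) -> U p]) => [i' j'|y].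
  have [[-> ->]|ne] := pselect ((i', j') = (ord0, i)).
    by apply: filterS nU => p + _.
  by apply: filterS filterT => p _ /ne.
by apply.
Qed.

Lemma torus_coordB (i : 'I_d) : {morph (fun x : Td => x ord0 i : T) : x y / x - y}.
Proof. by move=> x y; rewrite !mxE. Qed.

Variable n : nat.

(* [side i] is the number of arcs in direction [i]; it is congruent to 1
   modulo the product [modulus i] of the preceding ones. *)
Fixpoint modulus (i : nat) : nat :=
  if i is i'.+1 then modulus i' * (modulus i' * n).+1 else 1.

Definition side (i : nat) : nat := (modulus i * n).+1.

Lemma modulus_gt0 i : (0 < modulus i)%N.
Proof. by elim: i => //= i IH; rewrite muln_gt0 IH. Qed.

Lemma coprime_modulus_side i : coprime (modulus i) (side i).
Proof. by rewrite /coprime /side mulnC -addn1 gcdnMDl gcdn1. Qed.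

Lemma side_gt i : (n < side i)%N.
Proof. by rewrite ltnS leq_pmull// modulus_gt0. Qed.

Lemma torus_cyclic_partition : exists2 c : Td -> nat,
  cyclic_partition (modulus d) c (\row_i \pi_T ((side i)%:R^-1)) &
  forall x y, c x = c y -> forall i : 'I_d,
    circle_cell (side i) (x ord0 i) = circle_cell (side i) (y ord0 i).
Proof.
set t : Td := \row_i _.
(* Induction on the number [k] of coordinates already cut, starting from a single cell; [t] is the
   full vector throughout, so every stage has the same generator. *)
suff H k : (k <= d)%N -> exists2 c : Td -> nat, cyclic_partition (modulus k) c t &
    forall x y, c x = c y -> forall i : 'I_d, (i < k)%N ->
      circle_cell (side i) (x ord0 i) = circle_cell (side i) (y ord0 i).
  by have [c cP cE] := H d (leqnn d); exists c => // x y /cE xy i; exact: xy.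
elim: k => [_|k IH kd].
  exists (fun=> 0%N) => //; split=> // a /=.
  have [->|a0] := eqVneq a 0%N.
    by rewrite (_ : [set x | _] = setT)//; apply/seteqP; split.
  rewrite (_ : [set x | _] = set0)//; apply/seteqP; split => // x /= /esym/eqP.
  exact/negP.
have [c cP cE] := IH (ltnW kd); pose ik := Ordinal kd.
have kP : cyclic_partition (side k) (circle_cell (side k) \o fun x : Td => x ord0 ik) t.
  apply: circle_cell_partition => //; [exact: torus_coord_continuous|exact: torus_coordB|].
  by rewrite mxE.
have [b bP bE] := cyclic_partition_chinese (coprime_modulus_side k) cP kP.
exists b => // x y /bE[/cE xy xyk] i; rewrite ltnS leq_eqVlt => /predU1P[ik_|/xy//].
by rewrite (_ : i = ik)//; apply: val_inj.
Qed.

End torus_cells.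

(** * Common partitions of circle and torus *)

Lemma torus_circle_fine_partitions (R : realType) (d : nat) :
  fine_common_partitions (torus R d) (circle R).
Proof.
move=> W [P nP PW].
have /choice[m mP] : forall i : 'I_d, exists m : nat, forall (N : nat) (e : R),
    (m < N)%N -> `|e| < N%:R^-1 -> P ord0 i (\pi_(circle R) e).
  by move=> i; apply: nbhs_circle0; have := nP ord0 i; rewrite mxE.
(* Every [side n i] exceeds [n], so this one bound makes the boxes small enough in all
   directions. *)
pose n := (\max_i m i)%N; have [c cP cE] := torus_cyclic_partition R d n.
exists (modulus n d), c, (\row_i \pi_(circle R) ((side n i)%:R^-1)).
exists (circle_cell (modulus n d) \o id), (\pi_(circle R) ((modulus n d)%:R^-1)).
split=> //; first by apply: circle_cell_partition => //; [exact: modulus_gt0|move=> x; exact: cvg_id].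
move=> x y /cE xy; apply: PW => i j; rewrite (ord1 i) !mxE.
have [|e e1 ->] := circle_cell_sub _ (xy j); first by [].
by apply: mP e1; apply: leq_ltn_trans (side_gt _ _); exact: leq_bigmax.
Qed.

(** Only the circle cells have to be small, so the torus can be cut into slabs along its first
    coordinate, which exists because [d] is positive. *)
Lemma circle_torus_fine_partitions (R : realType) (d : nat) : (0 < d)%N ->
  fine_common_partitions (circle R) (torus R d).
Proof.
move=> d0 W /nbhs_circle0[n nW]; pose p : circle R := \pi_(circle R) (n.+1%:R^-1).
exists n.+1, (circle_cell n.+1 \o id), p.
exists (circle_cell n.+1 \o fun x : torus R d => x ord0 (Ordinal d0)), (\row_i p).
split.
- by apply: circle_cell_partition => // x; exact: cvg_id.
- apply: circle_cell_partition => //; [exact: torus_coord_continuous|exact: torus_coordB|].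
  by rewrite mxE.
- by move=> x y /circle_cell_sub[//|e e1 ->]; exact: nW e1.
Qed.

Theorem theorem10 (R : realType) (d : nat) (d_gt0 : (0 < d)%N)
    (mu : probability (borel (circle R)) R) (mu_haar : is_haar mu)
    (nu : probability (borel (torus R d)) R) (nu_haar : is_haar nu)
    (G : sgraph) :
  sigma mu G = sigma nu G.
Proof.
apply/eqP; rewrite eq_le; apply/andP; split; apply: sigma_le => //.
- exact: circle_torus_fine_partitions.
- exact: torus_circle_fine_partitions.
Qed.
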